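(* Let $P=\langle L,\ell^o,\ell^e,V,\tau_P\rangle$ be a program and run the algorithm SPACER (described in the context) on $P$. If SPACER returns SAFE then $P$ is safe, and if SPACER returns UNSAFE then $P$ is unsafe.
   Context: A program is a tuple $P=\langle L,\ell^o,\ell^e,V,\tau\rangle$: $L$ a finite set of control locations, $\ell^o,\ell^e\in L$ the initial and error locations, $V$ a set of Boolean or rational variables, and $\tau:L\times L\to \mathrm{BExpr}(V\cup V')$ mapping pairs of locations to quantifier-free formulas of propositional linear rational arithmetic over current variables $V$ and primed next-state copies $V'$; it is assumed that $\tau(\ell,\ell^o)=\bot$ and $\tau(\ell^e,\ell)=\bot$ for all $\ell$. For a formula $X$, $X'$ is $X$ with all variables primed. A control path is a sequence $\ell^o=\ell_0,\ell_1,\dots,\ell_k$ with $\tau(\ell_i,\ell_{i+1})\neq\bot$; it is feasible if there are states (valuations of $V$) $s_0,\dots,s_k$ with $\tau(\ell_i,\ell_{i+1})[V\leftarrow s_i,V'\leftarrow s_{i+1}]=\top$ for all $i<k$. A counterexample is a pair $\langle\bar\ell,\bar s\rangle$ of a feasible control path ending in $\ell^e$ and a witnessing state sequence; $P$ is safe iff $\ell^e$ lies at the end of no feasible control path. A safety proof is $\pi:L\to 2^{\mathrm{BExpr}(V)}$ with $\bigwedge\pi(\ell^e)\Rightarrow\bot$, $\top\Rightarrow\bigwedge\pi(\ell^o)$ and $(\bigwedge\pi(\ell_i)\wedge\tau(\ell_i,\ell_j))\Rightarrow\bigwedge\pi(\ell_j)'$ for all $\ell_i,\ell_j$. For programs $P_1,P_2$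 and a surjection $\sigma:L_1\to L_2$, $P_1\preceq_\sigma P_2$ iff $V_1=V_2$, $\sigma(\ell^o_1)=\ell^o_2$, $\sigma(\ell^e_1)=\ell^e_2$ and $\tau_1(\ell_i,\ell_j)\Rightarrow\tau_2(\sigma(\ell_i),\sigma(\ell_j))$ for all $\ell_i,\ell_j\in L_1$; $P_1\prec_\sigma P_2$ iff $P_1\preceq_\sigma P_2$ and there is no surjection $\nu$ with $P_2\preceq_\nu P_1$. For a transition relation $\tau$ on $L_2$, $\sigma(\tau)(\ell_1,\ell_2)=\tau(\sigma(\ell_1),\sigma(\ell_2))$; $\sigma(\langle\bar\ell,\bar s\rangle)=\langle\sigma(\bar\ell),\bar s\rangle$. $\mathrm{Adapt}(U,\tau,\sigma)$ is $U$ with $\tau_U$ replaced by $\tau_U\wedge\sigma(\tau)$. Algorithm SPACER on input $P$: it maintains $\mathcal{I}:L_P\to 2^{\mathrm{BExpr}(V_P)}$ (initially $\mathcal{I}(\ell)=\emptyset$ for all $\ell$), an abstraction $A$ (initially $A=P$; always $A$ differs from $P$ only in its transition relation) and an under-approximation $U$ with a surjection $\sigma:L_U\to L_P$ such that $U\preceq_\sigma A$ (initially arbitrary such $U,\sigma$). For $U\preceq_\sigma A$, $U_{\mathcal{I}}$ denotes $U$ with $\tau_U$ strengthened to $\lambda\ell_1,\ell_2.\ \bigwedge\mathcal{I}(\sigma(\ell_1))\wedge\tau_U(\ell_1,\ell_2)\wedge\bigwedge\mathcal{I}(\sigma(\ell_2))'$ (and $A_{\mathcal{I}}$ similarly with $\sigma=\mathrm{id}$).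 Each iteration calls an oracle Solve on $U_{\mathcal{I}}$, which returns either a safety proof $\pi$ of $U_{\mathcal{I}}$ or a counterexample $\mathscr{C}$ of $U_{\mathcal{I}}$. (Safe case.) ExtractInvs: for each $\ell\in L_P$ let $\mathcal{R}(\ell)$ be the set of conjuncts of $\bigvee\{\bigwedge\pi(u): u\in L_U,\sigma(u)=\ell\}$; then, while there exist $\ell_i,\ell_j\in L_P$ and $\varphi\in\mathcal{R}(\ell_j)$ such that $\bigwedge\mathcal{R}(\ell_i)\wedge\bigwedge\mathcal{I}(\ell_i)\wedge\tau_P(\ell_i,\ell_j)\not\Rightarrow\varphi'$, remove $\varphi$ from $\mathcal{R}(\ell_j)$; then set $\mathcal{I}(\ell):=\mathcal{I}(\ell)\cup\mathcal{R}(\ell)$ for all $\ell$. If $\bigwedge\mathcal{I}(\ell^e)\Rightarrow\bot$, return SAFE. Otherwise Abstract: writing $\tau_U=\sigma(\tau_A)\wedge\rho$, choose $\hat\tau_P$ with $\tau_P\Rightarrow\hat\tau_P$ and $\hat\rho$ with $\rho\Rightarrow\hat\rho$ such that, for $\hat U$ equal to $U$ but with $\tau_{\hat U}=\sigma(\hat\tau_P)\wedge\hat\rho$, $\pi$ is a safety proof of $\hat U_{\mathcal{I}}$; set $A:=A$ with $\tau_A$ replaced by $\hat\tau_P$ and $U:=\hat U$. Then NextU: choose $\hat U$, $\sigma_1,\sigma_2$ with $U\prec_{\sigma_1}\hat U\preceq_{\sigma_2}A$, $\sigma=\sigma_2\circ\sigma_1$ and $\mathrm{Adapt}(U,\tau_P,\sigma)\prec\mathrm{Adapt}(\hat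 U,\tau_P,\sigma_2)$; set $U:=\hat U$, $\sigma:=\sigma_2$. (Unsafe case.) Refine: if $\sigma(\mathscr{C})$ is a counterexample of $P$, return UNSAFE; otherwise choose $A_{new}$ with $A_{new}\prec_{\mathrm{id}}A$ such that $\sigma(\mathscr{C})$ is not a counterexample of $(A_{new})_{\mathcal{I}}$, and set $A:=A_{new}$, $U:=\mathrm{Adapt}(U,\tau_{A_{new}},\sigma)$. *)

(* Defs.v *)
From HB Require Import structures.
From mathcomp Require Import all_boot all_order all_algebra.
From mathcomp Require Import finmap boolp.

Set Implicit Arguments.
Unset Strict Implicit.
Unset Printing Implicit Defensive.

Import GRing.Theory Num.Theory.

Local Open Scope fset_scope.

(** * Propositional linear rational arithmetic *)

Record vocabulary : Type := Vocabulary { bvar : Type; qvar : Type }.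

Inductive lterm (V : vocabulary) : Type :=
| LVar of qvar V
| LConst of rat
| LAdd of lterm V & lterm V
| LScale of rat & lterm V.

Inductive bexpr (V : vocabulary) : Type :=
| BTop
| BBot
| BVar of bvar V
| BLe of lterm V & lterm V
| BLt of lterm V & lterm V
| BEq of lterm V & lterm V
| BNot of bexpr V
| BAnd of bexpr V & bexpr V
| BOr of bexpr V & bexpr V.

Arguments LConst {V}.
Arguments BTop {V}.
Arguments BBot {V}.

(* Classical equality and choice on formulas, so that [{fset bexpr V}] is
   available over arbitrary sets of variables. *)
HB.instance Definition _ (V : vocabulary) := gen_eqMixin (bexpr V).
HB.instance Definition _ (V : vocabulary) := gen_choiceMixin (bexpr V).

Record state (V : vocabulary) : Type :=
  State { bval : bvar V -> bool; qval : qvar V -> rat }.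

Fixpoint leval (V : vocabulary) (s : state V) (t : lterm V) : rat :=
  match t with
  | LVar x => qval s x
  | LConst c => c
  | LAdd t1 t2 => (leval s t1 + leval s t2)%R
  | LScale c t1 => (c * leval s t1)%R
  end.

Fixpoint holds (V : vocabulary) (s : state V) (phi : bexpr V) : bool :=
  match phi with
  | BTop => true
  | BBot => false
  | BVar b => bval s b
  | BLe t1 t2 => (leval s t1 <= leval s t2)%R
  | BLt t1 t2 => (leval s t1 < leval s t2)%R
  | BEq t1 t2 => leval s t1 == leval s t2
  | BNot f => ~~ holds s f
  | BAnd f g => holds s f && holds s g
  | BOr f g => holds s f || holds s g
  end.

Definition entails (V : vocabulary) (phi psi : bexpr V) : Prop :=
  forall s : state V, holds s phi -> holds s psi.

Definition equivalent (V : vocabulary) (phi psi : bexpr V) : Prop :=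
  entails phi psi /\ entails psi phi.

Definition bigand (V : vocabulary) (S : {fset bexpr V}) : bexpr V :=
  \big[@BAnd V/BTop]_(phi <- S) phi.

(** * Primed variables *)

(* [doubled V] is V ∪ V': [inl] marks the current copy, [inr] the primed one. *)
Definition doubled (V : vocabulary) : vocabulary :=
  Vocabulary (bvar V + bvar V) (qvar V + qvar V).

Fixpoint lrename (V W : vocabulary) (fq : qvar V -> qvar W)
    (t : lterm V) : lterm W :=
  match t with
  | LVar x => LVar (fq x)
  | LConst c => LConst c
  | LAdd t1 t2 => LAdd (lrename fq t1) (lrename fq t2)
  | LScale c t1 => LScale c (lrename fq t1)
  end.

Fixpoint rename (V W : vocabulary) (fb : bvar V -> bvar W)
    (fq : qvar V -> qvar W) (phi : bexpr V) : bexpr W :=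
  match phi with
  | BTop => BTop
  | BBot => BBot
  | BVar b => BVar (fb b)
  | BLe t1 t2 => BLe (lrename fq t1) (lrename fq t2)
  | BLt t1 t2 => BLt (lrename fq t1) (lrename fq t2)
  | BEq t1 t2 => BEq (lrename fq t1) (lrename fq t2)
  | BNot f => BNot (rename fb fq f)
  | BAnd f g => BAnd (rename fb fq f) (rename fb fq g)
  | BOr f g => BOr (rename fb fq f) (rename fb fq g)
  end.

Definition unprimed (V : vocabulary) (phi : bexpr V) : bexpr (doubled V) :=
  @rename V (doubled V) inl inl phi.

Definition primed (V : vocabulary) (phi : bexpr V) : bexpr (doubled V) :=
  @rename V (doubled V) inr inr phi.

(* The valuation [V <- s, V' <- s']. *)
Definition state_pair (V : vocabulary) (s s' : state V) : state (doubled V) :=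
  @State (doubled V)
    (fun b => match b with inl x => bval s x | inr x => bval s' x end)
    (fun q => match q with inl x => qval s x | inr x => qval s' x end).

(** * Programs *)

Record skeleton : Type := Skeleton { loc : finType; init : loc; err : loc }.

(* Equality with bottom is logical equivalence (here [phi] entails bottom):
   the assumption has to survive conjoining formulas to transitions, which is
   what every operation on programs below does. *)
Record trel (V : vocabulary) (K : skeleton) : Type := Trel {
  trans :> loc K -> loc K -> bexpr (doubled V);
  trans_init : forall l, equivalent (trans l (init K)) BBot;
  trans_err : forall l, equivalent (trans (err K) l) BBot
}.

Record program (V : vocabulary) : Type := Program {
  skel :> skeleton;
  tau : trel V skel
}.

Lemma trel_strengthen_init (V : vocabulary) (K : skeleton) (t : trel V K)
    (r : loc K -> loc K -> bexpr (doubled V)) :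
  (forall l1 l2, entails (r l1 l2) (t l1 l2)) ->
  forall l, equivalent (r l (init K)) BBot.
Proof.
by move=> rt l; split=> // s /rt; have [h _] := trans_init t l; apply: h.
Qed.

Lemma trel_strengthen_err (V : vocabulary) (K : skeleton) (t : trel V K)
    (r : loc K -> loc K -> bexpr (doubled V)) :
  (forall l1 l2, entails (r l1 l2) (t l1 l2)) ->
  forall l, equivalent (r (err K) l) BBot.
Proof.
by move=> rt l; split=> // s /rt; have [h _] := trans_err t l; apply: h.
Qed.

Definition trel_strengthen (V : vocabulary) (K : skeleton) (t : trel V K)
    (r : loc K -> loc K -> bexpr (doubled V))
    (rt : forall l1 l2, entails (r l1 l2) (t l1 l2)) : trel V K :=
  Trel (trel_strengthen_init rt) (trel_strengthen_err rt).

(** * Paths, counterexamples, safety *)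

Definition control_path (V : vocabulary) (P : program V) (k : nat)
    (ls : 'I_k.+1 -> loc P) : Prop :=
  ls ord0 = init P /\
  forall i : nat, i < k ->
    ~ equivalent (tau P (ls (inord i)) (ls (inord i.+1))) BBot.

Definition witnesses (V : vocabulary) (P : program V) (k : nat)
    (ls : 'I_k.+1 -> loc P) (ss : 'I_k.+1 -> state V) : Prop :=
  forall i : nat, i < k ->
    holds (state_pair (ss (inord i)) (ss (inord i.+1)))
          (tau P (ls (inord i)) (ls (inord i.+1))).

Definition feasible (V : vocabulary) (P : program V) (k : nat)
    (ls : 'I_k.+1 -> loc P) : Prop :=
  control_path ls /\ exists ss : 'I_k.+1 -> state V, witnesses ls ss.

Record trace (V : vocabulary) (L : Type) : Type := Trace {
  len : nat;
  locs : 'I_len.+1 -> L;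
  states : 'I_len.+1 -> state V
}.
Arguments locs {V L} t i.
Arguments states {V L} t i.

Definition map_trace (V : vocabulary) (L M : Type) (sigma : L -> M)
    (C : trace V L) : trace V M :=
  Trace (fun i => sigma (locs C i)) (states C).

Definition counterexample (V : vocabulary) (P : program V)
    (C : trace V (loc P)) : Prop :=
  [/\ feasible (locs C), locs C ord_max = err P
    & witnesses (locs C) (states C)].

Definition safe (V : vocabulary) (P : program V) : Prop :=
  ~ exists (k : nat) (ls : 'I_k.+1 -> loc P),
      feasible ls /\ ls ord_max = err P.

Definition safety_proof (V : vocabulary) (P : program V)
    (pi : loc P -> {fset bexpr V}) : Prop :=
  [/\ entails (bigand (pi (err P))) BBot,
      entails BTop (bigand (pi (init P)))
    & forall li lj : loc P,
        entails (BAnd (unprimed (bigand (pi li))) (tau P li lj))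
                (primed (bigand (pi lj)))].

(** * Abstraction preorder *)

Definition refines (V : vocabulary) (P1 P2 : program V)
    (sigma : loc P1 -> loc P2) : Prop :=
  [/\ forall y : loc P2, exists x : loc P1, sigma x = y,
      sigma (init P1) = init P2,
      sigma (err P1) = err P2
    & forall li lj : loc P1,
        entails (tau P1 li lj) (tau P2 (sigma li) (sigma lj))].

Definition srefines (V : vocabulary) (P1 P2 : program V)
    (sigma : loc P1 -> loc P2) : Prop :=
  @refines V P1 P2 sigma /\
  ~ exists nu : loc P2 -> loc P1, @refines V P2 P1 nu.

Definition pullback (V : vocabulary) (L M : Type) (sigma : L -> M)
    (t : M -> M -> bexpr (doubled V)) : L -> L -> bexpr (doubled V) :=
  fun l1 l2 => t (sigma l1) (sigma l2).

Lemma adapt_entails (V : vocabulary) (U : program V) (M : Type)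
    (t : M -> M -> bexpr (doubled V)) (sigma : loc U -> M) (l1 l2 : loc U) :
  entails (BAnd (tau U l1 l2) (pullback sigma t l1 l2)) (tau U l1 l2).
Proof. by move=> s /= /andP[]. Qed.

Definition adapt (V : vocabulary) (U : program V) (M : Type)
    (t : M -> M -> bexpr (doubled V)) (sigma : loc U -> M) : program V :=
  Program (trel_strengthen (@adapt_entails V U M t sigma)).

Lemma restrict_entails (V : vocabulary) (U : program V) (M : Type)
    (I : M -> {fset bexpr V}) (sigma : loc U -> M) (l1 l2 : loc U) :
  entails (BAnd (BAnd (unprimed (bigand (I (sigma l1)))) (tau U l1 l2))
                (primed (bigand (I (sigma l2)))))
          (tau U l1 l2).
Proof. by move=> s /= /andP[/andP[]]. Qed.

(* The program U_I; A_I is [restrict I id]. *)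
Definition restrict (V : vocabulary) (U : program V) (M : Type)
    (I : M -> {fset bexpr V}) (sigma : loc U -> M) : program V :=
  Program (trel_strengthen (@restrict_entails V U M I sigma)).

(** * SPACER *)

Section Spacer.
Variables (V : vocabulary) (P : program V).

(* A program that differs from P only in its transition relation. *)
Definition with_tau (t : trel V P) : program V := Program t.

(* The abstraction A is [with_tau (tauA c)]. *)
Record config : Type := Config {
  invs : loc P -> {fset bexpr V};
  tauA : trel V P;
  under : program V;
  proj : loc under -> loc P
}.
Arguments proj c u : clear implicits.

Definition initial (c : config) : Prop :=
  [/\ forall l, invs c l = fset0,
      tauA c = tau P
    & @refines V (under c) (with_tau (tauA c)) (proj c)].

(* How a formula is split into conjuncts (syntactically, through a conjunctive
   normal form, ...) is left open: any finite set whose conjunction is the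
   given formula up to equivalence is allowed. *)
Definition conjuncts_of (phi : bexpr V) (S : {fset bexpr V}) : Prop :=
  equivalent phi (bigand S).

Definition refuted (I R : loc P -> {fset bexpr V}) (li lj : loc P)
    (phi : bexpr V) : Prop :=
  phi \in R lj /\
  ~ entails (BAnd (BAnd (unprimed (bigand (R li))) (unprimed (bigand (I li))))
                  (tau P li lj))
            (primed phi).

Definition remove (R : loc P -> {fset bexpr V}) (lj : loc P) (phi : bexpr V) :
    loc P -> {fset bexpr V} :=
  fun l => if l == lj then R l `\ phi else R l.

(* [prune I R R']: the while loop started at R may end with R'. *)
Inductive prune (I : loc P -> {fset bexpr V}) :
    (loc P -> {fset bexpr V}) -> (loc P -> {fset bexpr V}) -> Prop :=
| prune_done R :
    (forall li lj phi, ~ refuted I R li lj phi) -> prune I R R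
| prune_step R R' li lj phi :
    refuted I R li lj phi -> prune I (remove R lj phi) R' -> prune I R R'.

Definition extract_invs (I : loc P -> {fset bexpr V}) (U : program V)
    (sigma : loc U -> loc P) (pi : loc U -> {fset bexpr V})
    (I' : loc P -> {fset bexpr V}) : Prop :=
  exists R0 R : loc P -> {fset bexpr V},
    [/\ forall l, conjuncts_of
          (\big[@BOr V/BBot]_(u : loc U | sigma u == l) bigand (pi u)) (R0 l),
        prune I R0 R
      & forall l, I' l = I l `|` R l].

(* The result is the pair of transition relations of the new A and the new U.
   A decomposition [tau U = sigma(tA) /\ rho] is meant up to equivalence. *)
Definition abstraction (I : loc P -> {fset bexpr V}) (tA : trel V P)
    (U : program V) (sigma : loc U -> loc P) (pi : loc U -> {fset bexpr V})
    (tA' : trel V P) (tU' : trel V U) : Prop :=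
  exists rho rho' : loc U -> loc U -> bexpr (doubled V),
    [/\ forall l1 l2,
          equivalent (tau U l1 l2) (BAnd (pullback sigma tA l1 l2) (rho l1 l2)),
        forall l1 l2, entails (tau P l1 l2) (tA' l1 l2),
        forall l1 l2, entails (rho l1 l2) (rho' l1 l2),
        forall l1 l2, tU' l1 l2 = BAnd (pullback sigma tA' l1 l2) (rho' l1 l2)
      & @safety_proof V (@restrict V (Program tU') (loc P) I sigma) pi].

Definition next_under (tA : trel V P) (U : program V) (sigma : loc U -> loc P)
    (U' : program V) (sigma' : loc U' -> loc P) : Prop :=
  exists sigma1 : loc U -> loc U',
    [/\ @srefines V U U' sigma1,
        @refines V U' (with_tau tA) sigma',
        forall u, sigma u = sigma' (sigma1 u)
      & exists nu, @srefines V (adapt (tau P) sigma) (adapt (tau P) sigma') nu].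

Inductive verdict : Type := SAFE | UNSAFE.

Inductive iteration (c : config) : config + verdict -> Prop :=
| iter_safe pi I' :
    @safety_proof V (restrict (invs c) (proj c)) pi ->
    extract_invs (invs c) (proj c) pi I' ->
    entails (bigand (I' (err P))) BBot ->
    iteration c (inr SAFE)
| iter_next_under pi I' tA' tU' U' sigma' :
    @safety_proof V (restrict (invs c) (proj c)) pi ->
    extract_invs (invs c) (proj c) pi I' ->
    ~ entails (bigand (I' (err P))) BBot ->
    @abstraction I' (tauA c) (under c) (proj c) pi tA' tU' ->
    @next_under tA' (Program tU') (proj c) U' sigma' ->
    iteration c (inl (@Config I' tA' U' sigma'))
| iter_unsafe C :
    @counterexample V (restrict (invs c) (proj c)) C ->
    @counterexample V P (map_trace (proj c) C) ->
    iteration c (inr UNSAFE)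
| iter_refine C tA' :
    @counterexample V (restrict (invs c) (proj c)) C ->
    ~ @counterexample V P (map_trace (proj c) C) ->
    @srefines V (with_tau tA') (with_tau (tauA c)) id ->
    ~ @counterexample V (@restrict V (with_tau tA') (loc P) (invs c) id)
        (map_trace (proj c) C) ->
    iteration c
      (inl (@Config (invs c) tA' (@adapt V (under c) (loc P) tA' (proj c))
              (proj c))).

Inductive run (v : verdict) : config -> Prop :=
| run_return c : iteration c (inr v) -> run v c
| run_continue c c' : iteration c (inl c') -> run v c' -> run v c.

Definition spacer_returns (v : verdict) : Prop :=
  exists c : config, initial c /\ run v c.

End Spacer.

Arguments proj {V P} c u.

(* Main.v *)
Require Import Defs.
From mathcomp Require Import all_boot.
From mathcomp Require Import finmap boolp.

(** Soundness does not depend on how the abstraction and the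
    under-approximation are chosen: throughout a run the lemma map [I] is an
    inductive invariant of the input program itself. The candidates extracted
    from a safety proof of U hold initially because the projection maps the
    initial location of U to that of P, and pruning only leaves lemmas whose
    consecution is checked against the transition relation of P. Hence [I]
    over-approximates the reachable states of P, and SAFE is returned only when
    it excludes the error location. UNSAFE is returned only with a
    counterexample of P at hand. *)

Set Implicit Arguments.
Unset Strict Implicit.
Unset Printing Implicit Defensive.

Local Open Scope fset_scope.

Section Formulas.
Variable V : vocabulary.
Implicit Types (s : state V) (phi : bexpr V) (S : {fset bexpr V}).

Lemma holds_bigand s S :
  reflect (forall phi, phi \in S -> holds s phi) (holds s (bigand S)).
Proof.
rewrite /bigand (big_morph (holds s) (id1 := true) (op1 := andb)) //.
by rewrite big_all; apply: allP.
Qed.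

Lemma holds_bigor s (T : finType) (p : pred T) (F : T -> bexpr V) :
  holds s (\big[@BOr V/BBot]_(u | p u) F u) = [exists (u | p u), holds s (F u)].
Proof.
by rewrite (big_morph (holds s) (id1 := false) (op1 := orb)) // big_orE.
Qed.

(** [fb] fixes the Boolean part of the state, so that it is literally the state appearing in
    [holds_rename]. *)
Lemma leval_lrename (W : vocabulary) (fb : bvar V -> bvar W)
    (fq : qvar V -> qvar W) (s : state W) (t : lterm V) :
  leval s (lrename fq t) =
  leval (State (fun b => bval s (fb b)) (fun q => qval s (fq q))) t.
Proof. by elim: t => //= [t1 -> t2 ->|c t ->]. Qed.

Lemma holds_rename (W : vocabulary) (fb : bvar V -> bvar W)
    (fq : qvar V -> qvar W) (s : state W) phi :
  holds s (rename fb fq phi) =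
  holds (State (fun b => bval s (fb b)) (fun q => qval s (fq q))) phi.
Proof.
elim: phi => //= [t1 t2|t1 t2|t1 t2|f ->|f -> g ->|f -> g ->] //.
all: by rewrite !(leval_lrename fb).
Qed.

Lemma holds_unprimed s s' phi :
  holds (state_pair s s') (unprimed phi) = holds s phi.
Proof. by rewrite /unprimed holds_rename /=; case: s. Qed.

Lemma holds_primed s s' phi :
  holds (state_pair s s') (primed phi) = holds s' phi.
Proof. by rewrite /primed holds_rename /=; case: s'. Qed.

End Formulas.

Section Soundness.
Variables (V : vocabulary) (P : program V).
Implicit Types (I R : loc P -> {fset bexpr V}) (c : config P).

(** A safety proof of [P] minus its clause at the error location, stated on states; that clause
    becomes available once SAFE is returned. *)
Definition inductive_invariant I : Prop :=
  (forall s, holds s (bigand (I (init P)))) /\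
  (forall li lj s s', holds s (bigand (I li)) ->
     holds (state_pair s s') (tau P li lj) -> holds s' (bigand (I lj))).

Lemma inductive_invariant_reachable I (k : nat) (ls : 'I_k.+1 -> loc P)
    (ss : 'I_k.+1 -> state V) :
  inductive_invariant I -> ls ord0 = init P -> witnesses ls ss ->
  holds (ss ord_max) (bigand (I (ls ord_max))).
Proof.
move=> [Iinit Istep] ls0 wit.
have reach i : i <= k -> holds (ss (inord i)) (bigand (I (ls (inord i)))).
  elim: i => [_|i IHi lt_ik]; last exact: Istep (IHi (ltnW lt_ik)) (wit i lt_ik).
  have -> : inord 0 = ord0 :> 'I_k.+1 by apply: val_inj; rewrite /= inordK.
  by rewrite ls0.
have -> : ord_max = inord k :> 'I_k.+1 by apply: val_inj; rewrite /= inordK.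
exact: reach.
Qed.

Lemma inductive_invariant_safe I :
  inductive_invariant I -> entails (bigand (I (err P))) BBot -> safe P.
Proof.
move=> indI Ierr [k [ls [[[ls0 _] [ss wit]] lsk]]].
by have := inductive_invariant_reachable indI ls0 wit; rewrite lsk => /Ierr.
Qed.

Lemma prune_sub I R R' l phi : prune I R R' -> phi \in R' l -> phi \in R l.
Proof.
elim=> {R R'} // R R' li lj psi _ _ IH /IH.
by rewrite /remove; case: ifP => // _; rewrite in_fsetD1 => /andP[].
Qed.

(** The loop ends only through [prune_done], so its exit condition holds of the final candidates. *)
Lemma prune_not_refuted I R R' li lj phi :
  prune I R R' -> ~ refuted I R' li lj phi.
Proof. by elim. Qed.

Lemma extract_invs_inductive I (U : program V) (sigma : loc U -> loc P) pi I' :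
  sigma (init U) = init P -> entails BTop (bigand (pi (init U))) ->
  extract_invs I sigma pi I' -> inductive_invariant I -> inductive_invariant I'.
Proof.
move=> sigma0 pi0 [R0 [R [conjR0 pruneR I'E]]] [Iinit Istep]; split.
  move=> s; apply/holds_bigand => phi; rewrite I'E in_fsetU => /orP[].
    by move: phi; apply/holds_bigand.
  move=> /(prune_sub pruneR); move: phi; apply/holds_bigand.
  (* [init U] lies in the fibre over [init P], and the conjunction of [pi] is valid there, hence so
     is the disjunction split into [R0]. *)
  apply: (conjR0 _).1; rewrite holds_bigor; apply/existsP; exists (init U).
  by rewrite sigma0 eqxx; apply: pi0.
move=> li lj s s' /holds_bigand; rewrite I'E => I'li step.
have Ili : holds s (bigand (I li)).
  by apply/holds_bigand => phi phiI; apply: I'li; rewrite in_fsetU phiI.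
have Rli : holds s (bigand (R li)).
  by apply/holds_bigand => phi phiR; apply: I'li; rewrite in_fsetU phiR orbT.
apply/holds_bigand => phi; rewrite I'E in_fsetU => /orP[|phiR].
  by move: phi; apply/holds_bigand; apply: Istep Ili step.
(* Were [phi] false in [s'], the pair of [s] and [s'] would make [phi] refuted in the final [R]. *)
rewrite -(holds_primed s); apply: contrapT => not_phi.
apply: (prune_not_refuted (li := li) (lj := lj) (phi := phi) pruneR).
split=> // /(_ (state_pair s s')) ent; apply: not_phi; apply: ent.
by rewrite /= !holds_unprimed Rli Ili.
Qed.

(** The clause on [proj] makes the lemmas extracted next hold initially. *)
Definition sound_config c : Prop :=
  inductive_invariant (invs c) /\ proj c (init (under c)) = init P.

Lemma initial_sound c : initial c -> sound_config c.
Proof.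
move=> [I0 _ [_ proj0 _ _]]; split=> //.
by split=> *; apply/holds_bigand => phi; rewrite I0 in_fset0.
Qed.

Lemma iteration_sound c c' :
  iteration c (inl c') -> sound_config c -> sound_config c'.
Proof.
(* Refinement keeps [invs] and [proj], and [adapt] keeps the initial location, so that case is
   immediate. *)
move=> it; inversion it as [|pi I' tA' tU' U' sigma' [_ pi0 _] ext _ _ nextU| |];
  subst => -[indI proj0]; last by split.
split; first exact: extract_invs_inductive proj0 pi0 ext indI.
by have [sigma1 [_ [_ sigma'0 _ _] _ _]] := nextU.
Qed.

Lemma iteration_safe c : iteration c (inr SAFE) -> sound_config c -> safe P.
Proof.
move=> it; inversion it as [pi I' [_ pi0 _] ext I'err| | |] => -[indI proj0].
exact: inductive_invariant_safe (extract_invs_inductive proj0 pi0 ext indI) I'err.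
Qed.

Lemma iteration_unsafe c : iteration c (inr UNSAFE) -> ~ safe P.
Proof.
move=> it; inversion it as [| |C _ [feas errC _]|]; apply; do 2!eexists.
by split; [exact: feas | exact: errC].
Qed.

Lemma run_safe c : run SAFE c -> sound_config c -> safe P.
Proof.
elim=> {}c => [|c' it _ IH]; first exact: iteration_safe.
by move=> /(iteration_sound it).
Qed.

Lemma run_unsafe c : run UNSAFE c -> ~ safe P.
Proof. by elim=> {}c => [/iteration_unsafe|]. Qed.

End Soundness.

Theorem theorem1 (V : vocabulary) (P : program V) :
  (spacer_returns P SAFE -> safe P) /\ (spacer_returns P UNSAFE -> ~ safe P).
Proof.
split=> -[c [/initial_sound sound_c runc]]; last exact: run_unsafe runc.
exact: run_safe runc sound_c.
Qed.
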